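(* Let $(\mathbf R,\otimes,I)$ be a compact closed category and let $(\mathbf S,\odot,J)$ be a symmetric monoidal closed category with internal hom $[-,-]$ and evaluation morphisms $\mathrm{Eval}_{A,B}:[A,B]\odot A\to B$ for objects $A,B$ of $\mathbf S$. Let $E:\mathbf S\to\mathbf R$ be a strict monoidal functor that is bijective on objects. Assume that there is an object $\Omega\in\mathbf S$ and an $\mathbf R$-morphism $\omega:E(\Omega)\to I$ such that for each object $A\in\mathbf S$ the map $$\mathbf S(A,\Omega)\to\mathbf R(E(A),I),\qquad f\mapsto\omega\circ E(f)$$ is a bijection. For each object $X\in\mathbf R$, let $P(X):=[E^{-1}(X^* ),\Omega]$. Then the assignment $X\mapsto P(X)$ extends to a functor $P:\mathbf R\to\mathbf S$ that is right adjoint to $E$. The $X$-component of the counit $\ni$ of this adjunction is the unique $\mathbf R$-morphism $\ni_X:EP(X)\to X$ such that $$\omega\circ E(\mathrm{Eval}_{E^{-1}(X^* ),\Omega})=\llcorner\ni_X\lrcorner.$$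
   Context: A symmetric monoidal category $(\mathbf R,\otimes,I)$ is compact closed if each object $X$ has a dual $X^*$ with morphisms $\eta_X:I\to X^*\otimes X$ and $\epsilon_X:X\otimes X^*\to I$ satisfying the two zigzag identities. For $f:X\to Y$ in $\mathbf R$, its coname is $\llcorner f\lrcorner:=\epsilon_Y\circ(f\otimes\mathrm{id}_{Y^*}):X\otimes Y^*\to I$. $(\mathbf S,\odot,J)$ is monoidal closed with evaluation $\mathrm{Eval}$ in the sense that for every $f:C\odot A\to B$ there is a unique $\hat f:C\to[A,B]$ with $\mathrm{Eval}_{A,B}\circ(\hat f\odot\mathrm{id}_A)=f$. A (symmetric) monoidal functor is strict if all of its coherence morphisms are identities; in particular $E(A\odot B)=E(A)\otimes E(B)$ and $E(J)=I$. $E^{-1}(X^* )$ denotes the unique object of $\mathbf S$ sent by $E$ to $X^*$. *)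

(* Defs.v *)
From mathcomp Require Import ssreflect ssrfun ssrbool.

Set Implicit Arguments.
Unset Strict Implicit.
Unset Printing Implicit Defensive.

Declare Scope cat_scope.
Delimit Scope cat_scope with cat.
Local Open Scope cat_scope.

Reserved Notation "X ~> Y" (at level 70, no associativity).
Reserved Notation "g ∘ f" (at level 40, left associativity).
Reserved Notation "X ⊗ Y" (at level 30, right associativity).
Reserved Notation "f ⊠ g" (at level 30, right associativity).

Record category := Category {
  obj :> Type;
  hom : obj -> obj -> Type where "X ~> Y" := (hom X Y);
  idm : forall X, X ~> X;
  comp : forall X Y Z, Y ~> Z -> X ~> Y -> X ~> Z
    where "g ∘ f" := (comp g f);
  comp1m : forall X Y (f : X ~> Y), idm Y ∘ f = f;
  compm1 : forall X Y (f : X ~> Y), f ∘ idm X = f;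
  compA : forall W X Y Z (h : Y ~> Z) (g : X ~> Y) (f : W ~> X),
    h ∘ (g ∘ f) = (h ∘ g) ∘ f
}.
Arguments idm {c} X.

Notation "X ~> Y" := (hom X Y) : cat_scope.
Notation "g ∘ f" := (comp g f) : cat_scope.

(* The identity morphism of X, retyped along an equality of objects. *)
Definition eq_hom (C : category) (X Y : C) (e : X = Y) : X ~> Y :=
  match e in _ = Z return X ~> Z with erefl => idm X end.

Definition is_identity (C : category) (X Y : C) (f : X ~> Y) : Prop :=
  exists e : X = Y, f = eq_hom e.

(* [functor_on F0] is the type of extensions of the assignment on objects [F0]
   to a functor. *)
Record functor_on (C D : category) (F0 : C -> D) := FunctorOn {
  fmap_on : forall X Y, X ~> Y -> F0 X ~> F0 Y;
  fmap_on1 : forall X, fmap_on (idm X) = idm (F0 X);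
  fmap_onM : forall X Y Z (g : Y ~> Z) (f : X ~> Y),
    fmap_on (g ∘ f) = fmap_on g ∘ fmap_on f
}.

Record functor (C D : category) := Functor {
  fobj :> C -> D;
  functor_struct : functor_on fobj
}.

Definition fmap (C D : category) (F : functor C D) (X Y : C) (f : X ~> Y) :
  F X ~> F Y := fmap_on (functor_struct F) f.

Record adjunction (C D : category) (F : functor C D) (G : functor D C) :=
  Adjunction {
  adj_unit : forall A : C, A ~> G (F A);
  adj_counit : forall X : D, F (G X) ~> X;
  adj_unit_natural : forall (A B : C) (f : A ~> B),
    fmap G (fmap F f) ∘ adj_unit A = adj_unit B ∘ f;
  adj_counit_natural : forall (X Y : D) (f : X ~> Y),
    f ∘ adj_counit X = adj_counit Y ∘ fmap F (fmap G f);
  adj_triangle_left : forall A : C,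
    adj_counit (F A) ∘ fmap F (adj_unit A) = idm (F A);
  adj_triangle_right : forall X : D,
    fmap G (adj_counit X) ∘ adj_unit (G X) = idm (G X)
}.

Record monoidal_category := MonoidalCategory {
  mon_cat :> category;
  tens : mon_cat -> mon_cat -> mon_cat where "X ⊗ Y" := (tens X Y);
  tensm : forall X X' Y Y' : mon_cat,
    X ~> X' -> Y ~> Y' -> X ⊗ Y ~> X' ⊗ Y'
    where "f ⊠ g" := (tensm f g);
  tunit : mon_cat;
  assoc : forall X Y Z, (X ⊗ Y) ⊗ Z ~> X ⊗ (Y ⊗ Z);
  assoc_inv : forall X Y Z, X ⊗ (Y ⊗ Z) ~> (X ⊗ Y) ⊗ Z;
  lunit : forall X, tunit ⊗ X ~> X;
  lunit_inv : forall X, X ~> tunit ⊗ X;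
  runit : forall X, X ⊗ tunit ~> X;
  runit_inv : forall X, X ~> X ⊗ tunit;
  tensm1 : forall X Y : mon_cat, idm X ⊠ idm Y = idm (X ⊗ Y);
  tensmM : forall (X X' X'' Y Y' Y'' : mon_cat)
    (f' : X' ~> X'') (f : X ~> X') (g' : Y' ~> Y'') (g : Y ~> Y'),
    (f' ∘ f) ⊠ (g' ∘ g) = (f' ⊠ g') ∘ (f ⊠ g);
  assocK : forall X Y Z, assoc_inv X Y Z ∘ assoc X Y Z = idm _;
  assoc_invK : forall X Y Z, assoc X Y Z ∘ assoc_inv X Y Z = idm _;
  lunitK : forall X, lunit_inv X ∘ lunit X = idm _;
  lunit_invK : forall X, lunit X ∘ lunit_inv X = idm _;
  runitK : forall X, runit_inv X ∘ runit X = idm _;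
  runit_invK : forall X, runit X ∘ runit_inv X = idm _;
  assoc_natural : forall (X X' Y Y' Z Z' : mon_cat)
    (f : X ~> X') (g : Y ~> Y') (h : Z ~> Z'),
    assoc X' Y' Z' ∘ ((f ⊠ g) ⊠ h) = (f ⊠ (g ⊠ h)) ∘ assoc X Y Z;
  lunit_natural : forall (X Y : mon_cat) (f : X ~> Y),
    lunit Y ∘ (idm tunit ⊠ f) = f ∘ lunit X;
  runit_natural : forall (X Y : mon_cat) (f : X ~> Y),
    runit Y ∘ (f ⊠ idm tunit) = f ∘ runit X;
  tens_pentagon : forall W X Y Z,
    assoc W X (Y ⊗ Z) ∘ assoc (W ⊗ X) Y Z =
    (idm W ⊠ assoc X Y Z) ∘ assoc W (X ⊗ Y) Z ∘ (assoc W X Y ⊠ idm Z);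
  tens_triangle : forall X Y,
    (idm X ⊠ lunit Y) ∘ assoc X tunit Y = runit X ⊠ idm Y
}.
Arguments tunit {m}.

Notation "X ⊗ Y" := (tens X Y) : cat_scope.
Notation "f ⊠ g" := (tensm f g) : cat_scope.

Record symmetric_monoidal_category := SymmetricMonoidalCategory {
  sym_mon :> monoidal_category;
  braid : forall X Y : sym_mon, X ⊗ Y ~> Y ⊗ X;
  braid_natural : forall (X X' Y Y' : sym_mon) (f : X ~> X') (g : Y ~> Y'),
    braid X' Y' ∘ (f ⊠ g) = (g ⊠ f) ∘ braid X Y;
  braidK : forall X Y, braid Y X ∘ braid X Y = idm (X ⊗ Y);
  braid_hexagon : forall X Y Z,
    assoc Y Z X ∘ braid X (Y ⊗ Z) ∘ assoc X Y Z =
    (idm Y ⊠ braid X Z) ∘ assoc Y X Z ∘ (braid X Y ⊠ idm Z)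
}.

Record compact_closed_category := CompactClosedCategory {
  cc_smc :> symmetric_monoidal_category;
  dual : cc_smc -> cc_smc;
  cc_eta : forall X : cc_smc, tunit ~> dual X ⊗ X;
  cc_eps : forall X : cc_smc, X ⊗ dual X ~> tunit;
  cc_zigzag : forall X : cc_smc,
    lunit X ∘ (cc_eps X ⊠ idm X) ∘ assoc_inv X (dual X) X
      ∘ (idm X ⊠ cc_eta X) ∘ runit_inv X = idm X;
  cc_zigzag_dual : forall X : cc_smc,
    runit (dual X) ∘ (idm (dual X) ⊠ cc_eps X) ∘ assoc (dual X) X (dual X)
      ∘ (cc_eta X ⊠ idm (dual X)) ∘ lunit_inv (dual X) = idm (dual X)
}.

Definition coname (R : compact_closed_category) (X Y : R) (f : X ~> Y) :
  X ⊗ dual Y ~> tunit := cc_eps Y ∘ (f ⊠ idm (dual Y)).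

Record symmetric_monoidal_closed_category := SymmetricMonoidalClosedCategory {
  smcc_smc :> symmetric_monoidal_category;
  ihom : smcc_smc -> smcc_smc -> smcc_smc;
  Eval : forall A B : smcc_smc, ihom A B ⊗ A ~> B;
  Eval_universal : forall (A B C : smcc_smc) (f : C ⊗ A ~> B),
    exists! fhat : C ~> ihom A B, Eval A B ∘ (fhat ⊠ idm A) = f
}.

(* Invertibility of the coherence morphisms is not part of this record; it is
   automatic for the strict functors below. *)
Record monoidal_functor (C D : monoidal_category) := MonoidalFunctor {
  mon_fun :> functor C D;
  mf_unit : tunit ~> mon_fun tunit;
  mf_tens : forall A B : C, mon_fun A ⊗ mon_fun B ~> mon_fun (A ⊗ B);
  mf_tens_natural : forall (A A' B B' : C) (f : A ~> A') (g : B ~> B'),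
    mf_tens A' B' ∘ (fmap mon_fun f ⊠ fmap mon_fun g) =
    fmap mon_fun (f ⊠ g) ∘ mf_tens A B;
  mf_assoc : forall A B C' : C,
    fmap mon_fun (assoc A B C') ∘ mf_tens (A ⊗ B) C'
      ∘ (mf_tens A B ⊠ idm (mon_fun C')) =
    mf_tens A (B ⊗ C') ∘ (idm (mon_fun A) ⊠ mf_tens B C')
      ∘ assoc (mon_fun A) (mon_fun B) (mon_fun C');
  mf_lunit : forall A : C,
    fmap mon_fun (lunit A) ∘ mf_tens tunit A
      ∘ (mf_unit ⊠ idm (mon_fun A)) = lunit (mon_fun A);
  mf_runit : forall A : C,
    fmap mon_fun (runit A) ∘ mf_tens A tunit
      ∘ (idm (mon_fun A) ⊠ mf_unit) = runit (mon_fun A)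
}.

Record strict_monoidal_functor (C D : monoidal_category) :=
  StrictMonoidalFunctor {
  strict_fun :> monoidal_functor C D;
  strict_unit : is_identity (mf_unit strict_fun);
  strict_tens : forall A B : C, is_identity (mf_tens strict_fun A B)
}.

(* For [eY : E A = Y], the identification of [E B ⊗ Y] with [E (B ⊗ A)] given by
   strictness of [E]; it is an identity morphism up to retyping. *)
Definition strict_tens_eq (C D : monoidal_category)
  (E : strict_monoidal_functor C D) (A B : C) (Y : D) (eY : E A = Y) :
  E B ⊗ Y ~> E (B ⊗ A) :=
  mf_tens E B A ∘ (idm (E B) ⊠ eq_hom (esym eY)).

(* Main.v *)
From mathcomp Require Import ssreflect ssrfun ssrbool.
Require Import Defs.
From Stdlib Require Import IndefiniteDescription.

(** Since [R] is compact closed, taking conames is a bijection from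
    [E A ~> X] to [E A ⊗ dual X ~> tunit], and by strictness of [E] the latter
    is [E (A ⊗ Einv (dual X)) ~> tunit].  The hypothesis on [omega] identifies
    this with [A ⊗ Einv (dual X) ~> Omega], and currying with [A ~> P X].  The
    composite bijection is natural in [A], and the morphism corresponding to
    [idm (P X)] is the one whose coname is given by evaluation; it is therefore
    a universal arrow from [E] to [X], and universal arrows assemble into an
    adjunction. *)

Set Implicit Arguments.
Unset Strict Implicit.
Unset Printing Implicit Defensive.

Local Open Scope cat_scope.

Section Coherence.

Variable M : monoidal_category.
Implicit Types W X Y Z : M.

Lemma tensm_compl X X' X'' Y (f : X ~> X') (g : X' ~> X'') :
  (g ∘ f) ⊠ idm Y = (g ⊠ idm Y) ∘ (f ⊠ idm Y).
Proof. by rewrite -tensmM comp1m. Qed.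

Lemma tensm_compr X Y Y' Y'' (f : Y ~> Y') (g : Y' ~> Y'') :
  idm X ⊠ (g ∘ f) = (idm X ⊠ g) ∘ (idm X ⊠ f).
Proof. by rewrite -tensmM comp1m. Qed.

Lemma tensm_interchange X X' Y Y' (f : X ~> X') (g : Y ~> Y') :
  (f ⊠ idm Y') ∘ (idm X ⊠ g) = (idm X' ⊠ g) ∘ (f ⊠ idm Y).
Proof. by rewrite -!tensmM !comp1m !compm1. Qed.

Lemma assoc_inj W X Y Z (f g : W ~> (X ⊗ Y) ⊗ Z) :
  assoc X Y Z ∘ f = assoc X Y Z ∘ g -> f = g.
Proof.
move=> /(congr1 (fun h => assoc_inv X Y Z ∘ h)).
by rewrite !compA assocK !comp1m.
Qed.

Lemma assoc_surj W X Y Z (f g : X ⊗ (Y ⊗ Z) ~> W) :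
  f ∘ assoc X Y Z = g ∘ assoc X Y Z -> f = g.
Proof.
move=> /(congr1 (fun h => h ∘ assoc_inv X Y Z)).
by rewrite -!compA assoc_invK !compm1.
Qed.

Lemma assoc_inv_natural X X' Y Y' Z Z'
    (f : X ~> X') (g : Y ~> Y') (h : Z ~> Z') :
  assoc_inv X' Y' Z' ∘ (f ⊠ (g ⊠ h)) = ((f ⊠ g) ⊠ h) ∘ assoc_inv X Y Z.
Proof.
apply: assoc_inj; rewrite !compA assoc_invK comp1m assoc_natural.
by rewrite -compA assoc_invK compm1.
Qed.

Lemma runit_inv_natural X Y (f : X ~> Y) :
  (f ⊠ idm tunit) ∘ runit_inv X = runit_inv Y ∘ f.
Proof.
rewrite -[LHS]comp1m -(runitK Y) -!compA [runit Y ∘ _]compA runit_natural.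
by rewrite -compA runit_invK compm1.
Qed.

Lemma tensm_unit_faithful X Y (f g : X ~> Y) :
  f ⊠ idm (@tunit M) = g ⊠ idm tunit -> f = g.
Proof.
move=> /(congr1 (fun h => runit Y ∘ h)); rewrite !runit_natural.
move=> /(congr1 (fun h => h ∘ runit_inv X)).
by rewrite -!compA runit_invK !compm1.
Qed.

Lemma unit_tensm_faithful X Y (f g : X ~> Y) :
  idm (@tunit M) ⊠ f = idm tunit ⊠ g -> f = g.
Proof.
move=> /(congr1 (fun h => lunit Y ∘ h)); rewrite !lunit_natural.
move=> /(congr1 (fun h => h ∘ lunit_inv X)).
by rewrite -!compA lunit_invK !compm1.
Qed.

(** Tensoring with [tunit] is faithful, so it suffices to compare the two sides after [⊠ idm tunit].
    There the pentagon at [X], [Y], [tunit], [tunit] and two triangles give the equality. *)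
Lemma runit_tens X Y :
  (idm X ⊠ runit Y) ∘ assoc X Y tunit = runit (X ⊗ Y).
Proof.
apply: tensm_unit_faithful; apply: assoc_inj.
rewrite tensm_compl compA assoc_natural -(tens_triangle Y tunit) tensm_compr.
rewrite -[LHS]compA -[LHS]compA [_ ∘ (assoc _ _ _ ∘ _)]compA -tens_pentagon.
rewrite compA -assoc_natural -compA tensm1.
by rewrite tens_triangle.
Qed.

(** The mirror argument: tensor with [tunit] on the left and precompose with two invertible
    associators, so that the pentagon at [tunit], [tunit], [X], [Y] applies. *)
Lemma lunit_tens X Y :
  lunit (X ⊗ Y) ∘ assoc tunit X Y = lunit X ⊠ idm Y.
Proof.
apply: unit_tensm_faithful; apply: assoc_surj.
have epi (V W Z T : M) (p q : (V ⊗ (W ⊗ Z)) ⊗ T ~> tunit ⊗ (X ⊗ Y)) :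
    p ∘ (assoc V W Z ⊠ idm T) = q ∘ (assoc V W Z ⊠ idm T) -> p = q.
  move=> /(congr1 (fun h => h ∘ (assoc_inv V W Z ⊠ idm T))).
  by rewrite -!compA -!tensm_compl assoc_invK !tensm1 !compm1.
apply: epi.
rewrite tensm_compr -2![LHS]compA [_ ∘ (assoc _ _ _ ∘ _)]compA -tens_pentagon.
rewrite compA tens_triangle -[idm (X ⊗ Y)]tensm1 -assoc_natural.
by rewrite -assoc_natural -compA -tensm_compl tens_triangle.
Qed.

(** After tensoring with [tunit], [lunit_tens] and the triangle reduce this to [lunit (tunit ⊗
    tunit) = idm tunit ⊠ lunit tunit], which is naturality of [lunit] at itself, as [lunit] is
    invertible. *)
Lemma lunit_runit_unit : lunit (@tunit M) = runit tunit.
Proof.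
apply: tensm_unit_faithful; rewrite -lunit_tens -tens_triangle.
congr (_ ∘ _).
rewrite -[LHS]comp1m -[RHS]comp1m -(lunitK tunit) -!compA.
by rewrite lunit_natural.
Qed.

Lemma runit_inv_tens X Y :
  assoc X tunit Y ∘ (runit_inv X ⊠ idm Y) = idm X ⊠ lunit_inv Y.
Proof.
rewrite -[LHS]comp1m -tensm1 -(lunitK Y) tensm_compr -compA.
rewrite [_ ∘ (assoc _ _ _ ∘ _)]compA tens_triangle -tensm_compl.
by rewrite runit_invK tensm1 compm1.
Qed.

End Coherence.

Section Coname.

Variable R : compact_closed_category.
Implicit Types X Y Z : R.

(** The composite of [cc_zigzag] with [g] in place of [cc_eps]; it inverts [coname]. *)
Definition of_coname X Y (g : X ⊗ dual Y ~> tunit) : X ~> Y :=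
  lunit Y ∘ (g ⊠ idm Y) ∘ assoc_inv X (dual Y) Y
    ∘ (idm X ⊠ cc_eta Y) ∘ runit_inv X.

Lemma coname_comp X Y Z (g : Y ~> Z) (f : X ~> Y) :
  coname (g ∘ f) = coname g ∘ (f ⊠ idm (dual Z)).
Proof. by rewrite /coname tensm_compl compA. Qed.

Lemma conameK X Y : cancel (@coname R X Y) (@of_coname X Y).
Proof.
move=> f; rewrite /of_coname /coname tensm_compl.
rewrite -[RHS]comp1m -[in RHS](cc_zigzag Y) -!compA; congr (_ ∘ (_ ∘ _)).
(* Naturality slides [f] to the right end, leaving the zigzag of [Y] in front of it. *)
rewrite compA -assoc_inv_natural -compA; congr (_ ∘ _).
by rewrite tensm1 compA tensm_interchange -compA runit_inv_natural.
Qed.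

(** This is [cc_zigzag_dual] for [Y] tensored on the left with [X]; the pentagon and the unitor
    coherences rearrange the brackets. *)
Lemma coname_snake X Y :
  runit (X ⊗ dual Y) ∘ (idm (X ⊗ dual Y) ⊠ cc_eps Y)
    ∘ assoc (X ⊗ dual Y) Y (dual Y) ∘ (assoc_inv X (dual Y) Y ⊠ idm (dual Y))
    ∘ ((idm X ⊠ cc_eta Y) ⊠ idm (dual Y)) ∘ (runit_inv X ⊠ idm (dual Y))
  = idm (X ⊗ dual Y).
Proof.
have pent : assoc X (dual Y) (Y ⊗ dual Y) ∘ assoc (X ⊗ dual Y) Y (dual Y)
      ∘ (assoc_inv X (dual Y) Y ⊠ idm (dual Y))
    = (idm X ⊠ assoc (dual Y) Y (dual Y)) ∘ assoc X (dual Y ⊗ Y) (dual Y).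
  by rewrite tens_pentagon -compA -tensm_compl assoc_invK tensm1 compm1.
rewrite -[RHS]tensm1 -[in RHS](cc_zigzag_dual Y) !tensm_compr -runit_inv_tens.
rewrite -runit_tens -[idm (X ⊗ dual Y)]tensm1.
rewrite -[_ ∘ assoc _ _ _ ∘ (_ ⊠ cc_eps Y)]compA assoc_natural !compA.
congr (_ ∘ _); rewrite -[RHS]compA -assoc_natural !compA.
by congr (_ ∘ _); rewrite -[RHS]compA -pent !compA.
Qed.

Lemma of_conameK X Y : cancel (@of_coname X Y) (@coname R X Y).
Proof.
move=> g; rewrite /of_coname /coname !tensm_compl -lunit_tens.
(* Once [cc_eps] has passed through, the left unitor sits at [tunit]; read as a right unitor, it
   lets naturality pull [g] out in front of the snake. *)
rewrite !compA -lunit_natural lunit_runit_unit.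
rewrite -[_ ∘ assoc _ _ _ ∘ ((g ⊠ _) ⊠ _)]compA assoc_natural tensm1.
rewrite !compA -[_ ∘ _ ∘ (g ⊠ _)]compA -tensm_interchange !compA runit_natural.
by rewrite -!compA [X in g ∘ X](_ : _ = idm _) ?compm1 // !compA coname_snake.
Qed.

End Coname.

Lemma adjunction_of_universal_arrows (C D : category) (F : functor C D)
    (G0 : D -> C) (ni : forall X, F (G0 X) ~> X)
    (ni_universal : forall A X (f : F A ~> X),
       exists! g : A ~> G0 X, ni X ∘ fmap F g = f) :
  exists G_struct : functor_on G0,
  exists adj : adjunction F (Functor G_struct),
  forall X, adj_counit adj X = ni X.
Proof.
(* Unique existence lives in [Prop]; description turns it into the transposition function [tr]. *)
pose tr A X f := sval (constructive_indefinite_description _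
                         (@ni_universal A X f)).
have trK A X f : ni X ∘ fmap F (tr A X f) = f.
  by rewrite /tr; case: constructive_indefinite_description => ? [].
have trP A X (g h : A ~> G0 X) :
    ni X ∘ fmap F g = ni X ∘ fmap F h -> g = h.
  by move=> gh; have [k [_ uk]] := ni_universal _ _ (ni X ∘ fmap F h);
     rewrite -(uk g gh) -(uk h erefl).
have F1 A : fmap F (idm A) = idm (F A) by exact: fmap_on1.
have FM A B B' (g : B ~> B') (f : A ~> B) :
    fmap F (g ∘ f) = fmap F g ∘ fmap F f by exact: fmap_onM.
(* Naturality of [ni] forces this choice. Equations between maps into [G0 X] are then checked after
   composing with [ni X]. *)
pose G1 X Y (f : X ~> Y) : G0 X ~> G0 Y := tr _ _ (f ∘ ni X).
have G1K X Y (f : X ~> Y) : ni Y ∘ fmap F (G1 X Y f) = f ∘ ni X by exact: trK.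
have G11 X : G1 X X (idm X) = idm (G0 X).
  by apply: trP; rewrite G1K F1 comp1m compm1.
have G1M X Y Z (g : Y ~> Z) (f : X ~> Y) :
    G1 X Z (g ∘ f) = G1 Y Z g ∘ G1 X Y f.
  by apply: trP; rewrite FM compA !G1K -[RHS]compA G1K compA.
pose G := Functor (FunctorOn G11 G1M).
have GE X Y (f : X ~> Y) : fmap G f = G1 X Y f by [].
exists (FunctorOn G11 G1M).
unshelve eexists (@Adjunction _ _ F G (fun A => tr _ _ (idm (F A))) ni _ _ _ _)
  => //=.
- move=> A B f; apply: trP.
  by rewrite GE !FM !compA G1K trK comp1m -compA trK compm1.
- by move=> X; apply: trP; rewrite GE FM compA G1K -compA trK F1.
Qed.

Lemma eq_homK (C : category) (X Y : C) (e : X = Y) :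
  eq_hom (esym e) ∘ eq_hom e = idm X.
Proof. by case: Y / e; rewrite /= comp1m. Qed.

Lemma eq_homKV (C : category) (X Y : C) (e : X = Y) :
  eq_hom e ∘ eq_hom (esym e) = idm Y.
Proof. by case: Y / e; rewrite /= comp1m. Qed.

Section StrictTens.

Variables (C D : monoidal_category) (E : strict_monoidal_functor C D).
Variables (A : C) (Y : D) (eY : E A = Y).

Lemma strict_tens_eq_natural B B' (g : B ~> B') :
  strict_tens_eq B' eY ∘ (fmap E g ⊠ idm Y)
  = fmap E (g ⊠ idm A) ∘ strict_tens_eq B eY.
Proof.
rewrite /strict_tens_eq -compA -tensm_interchange.
rewrite compA [RHS]compA -mf_tens_natural.
by rewrite /fmap (fmap_on1 (functor_struct E)).
Qed.

Lemma strict_tens_eq_iso B :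
  exists2 t : E (B ⊗ A) ~> E B ⊗ Y,
    t ∘ strict_tens_eq B eY = idm _ & strict_tens_eq B eY ∘ t = idm _.
Proof.
have [e ->] : is_identity (strict_tens_eq B eY).
  rewrite /strict_tens_eq; case: (strict_tens E B A) => e ->.
  by case: Y / eY => /=; exists e; rewrite tensm1 compm1.
by exists (eq_hom (esym e)); [exact: eq_homK | exact: eq_homKV].
Qed.

End StrictTens.

Theorem theorem8p2
  (R : compact_closed_category) (S : symmetric_monoidal_closed_category)
  (E : strict_monoidal_functor S R)
  (E_bij : bijective (fun A : S => E A))
  (Einv : R -> S) (EinvE : forall X : R, E (Einv X) = X)
  (Omega : S) (omega : E Omega ~> tunit)
  (omega_bij : forall A : S,
     bijective (fun f : A ~> Omega => omega ∘ fmap E f)) :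
  let P0 := fun X : R => ihom (Einv (dual X)) Omega in
  exists P_struct : functor_on P0,
  let P := Functor P_struct in
  exists adj : adjunction E P,
  forall X : R,
    unique
      (fun ni : E (P X) ~> X =>
         omega ∘ fmap E (Eval (Einv (dual X)) Omega)
           ∘ strict_tens_eq (P X) (EinvE (dual X))
         = coname ni)
      (adj_counit adj X).
Proof.
move=> P0.
pose ev X := omega ∘ fmap E (Eval (Einv (dual X)) Omega)
               ∘ strict_tens_eq (P0 X) (EinvE (dual X)).
pose ni X : E (P0 X) ~> X := of_coname (ev X).
(* Through conames, factoring through [ni X] becomes factoring through [Eval]. *)
have coname_ni X A (g : A ~> P0 X) : coname (ni X ∘ fmap E g) =
    omega ∘ fmap E (Eval (Einv (dual X)) Omega ∘ (g ⊠ idm (Einv (dual X))))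
      ∘ strict_tens_eq A (EinvE (dual X)).
  rewrite coname_comp of_conameK /ev -compA strict_tens_eq_natural.
  by rewrite /fmap fmap_onM !compA.
have ni_universal A X (f : E A ~> X) :
    exists! g : A ~> P0 X, ni X ∘ fmap E g = f.
  have [t tK Kt] := strict_tens_eq_iso (EinvE (dual X)) A.
  have [w wK Kw] := omega_bij (A ⊗ Einv (dual X)).
  (* The transpose of [f]: take its coname, retype it along strictness by [t], lift it through
     [omega] by [w], then curry. *)
  have [g [gE g_uniq]] := Eval_universal (w (coname f ∘ t)).
  exists g; split=> [|h hE].
    apply: (can_inj (@conameK R _ _)).
    by rewrite coname_ni gE Kw -compA tK compm1.
  apply: g_uniq; apply: (can_inj wK).
  by rewrite Kw -hE coname_ni -[RHS]compA Kt compm1.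
have [P_struct [adj adjE]] := adjunction_of_universal_arrows ni_universal.
exists P_struct, adj => X; split=> [|n nE]; rewrite adjE.
  by rewrite of_conameK.
by apply: (can_inj (@conameK R _ _)); rewrite -nE of_conameK.
Qed.
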